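(* Let $a,b,n$ be positive integers with $a>b$, and define \[ t_1(an,bn,q)'=\sum_{k=an-bn-\lfloor n/2\rfloor}^{an-bn}(-1)^kq^{k(k-1)}\begin{bmatrix} an\\ k\end{bmatrix}_{q^2}\begin{bmatrix} 2an-2k\\ an-bn-k\end{bmatrix}. \] Then \[ t_1(an,bn,q)'\equiv(-1)^{an-bn}q^{(an-bn)(an-bn-1)}\begin{bmatrix} an\\ bn\end{bmatrix}_{q^2}\Big\{1-2(a-b)\big(1-\vartheta_n(q^{-1})\big)\Big\}\pmod{\Phi_n(q)^2}, \] where \[ \vartheta_n(q)=\begin{cases} (-1)^m(1+q^{2m})q^{m(3m-5)/2}, &\text{if } n=3m,\\ (-1)^mq^{m(3m+1)/2}, &\text{if } n=3m+1,\\ (-1)^{m+1}q^{(m-1)(3m+2)/2}, &\text{if } n=3m+2.\end{cases} \]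
   Context: For integers $n,m$, the $q$-binomial coefficient is $\begin{bmatrix} n\\ m\end{bmatrix}_q=\begin{bmatrix} n\\ m\end{bmatrix}=\frac{(1-q^n)(1-q^{n-1})\cdots(1-q^{n-m+1})}{(1-q)(1-q^2)\cdots(1-q^m)}$ if $0\le m\le n$, and $0$ otherwise; $\begin{bmatrix} n\\ m\end{bmatrix}_{q^2}$ is the same with $q$ replaced by $q^2$. $\Phi_n(q)$ denotes the $n$-th cyclotomic polynomial. $\lfloor x\rfloor$ is the integer part of $x$. For rational functions (including Laurent polynomials) $A(q),B(q)$, $A\equiv B\pmod{\Phi_n(q)^2}$ means $A-B=\Phi_n(q)^2P(q)/Q(q)$ with $P,Q\in\mathbb{Z}[q]$ and $Q$ coprime to $\Phi_n(q)$. *)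

(* Defs.v *)
From mathcomp Require Import all_boot all_order all_algebra all_field.

Set Implicit Arguments.
Unset Strict Implicit.
Unset Printing Implicit Defensive.

Import GRing.Theory.
Local Open Scope ring_scope.

Notation ratfun := {fraction {poly int}}.

Definition ratX : ratfun := tofrac 'X.

(* [n - i] is never truncated below, because [i < m <= n]. *)
Definition qbinom (F : fieldType) (q : F) (n m : nat) : F :=
  if (m <= n)%N
  then (\prod_(i < m) (1 - q ^+ (n - i))) / (\prod_(i < m) (1 - q ^+ i.+1))
  else 0.

(* For [b < a] and [0 < n], no natural-number subtraction below is truncated,
   except [k.-1] at [k = 0], where the exponent is [0] either way. *)
Definition t1' (F : fieldType) (q : F) (a b n : nat) : F :=
  \sum_(a * n - b * n - n./2 <= k < (a * n - b * n).+1)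
    (-1) ^+ k * q ^+ (k * k.-1)
      * qbinom (q ^+ 2) (a * n) k
      * qbinom q (2 * (a * n) - 2 * k) (a * n - b * n - k).

(* The exponents of [q] are integers that can be negative (at [n = 2], [3]);
   the divisions by 2 are exact. *)
Definition vartheta (F : fieldType) (n : nat) (q : F) : F :=
  let m := (n %/ 3)%N in
  let z := m%:Z in
  match (n %% 3)%N with
  | 0 => (-1) ^+ m * (1 + q ^+ (2 * m)) * q ^ ((z * (3 * z - 5)) %/ 2)%Z
  | 1 => (-1) ^+ m * q ^ ((z * (3 * z + 1)) %/ 2)%Z
  | _ => (-1) ^+ m.+1 * q ^ (((z - 1) * (3 * z + 2)) %/ 2)%Z
  end.

(* Since ['Phi_n] is monic, [coprimep] over [int] excludes every non-unit
   common divisor, constant or not; it also forces [Q != 0]. *)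
Definition eqmodPhi2 (n : nat) (A B : ratfun) : Prop :=
  exists P Q : {poly int},
    coprimep Q 'Phi_n /\ A - B = tofrac ('Phi_n ^+ 2 * P) / tofrac Q.

(* Main.v *)
Require Import Defs.
From mathcomp Require Import all_boot all_order all_algebra all_field.
From mathcomp Require Import ring zify.
Import GRing.Theory.
Local Open Scope ring_scope.

(** Put [K = (a - b) n] and [p = q^-1].  The term [k = K] of [t1'] is the
    prefactor [M] of the right-hand side, and the term [k = K - j], [j > 0], is
    [M (1 - q^(2K)) A_j] with [A_j] regular at the primitive [n]-th roots of 1.
    On the other side, [vartheta_n(p)] is exactly the sum over [j <= n/2] of
    [(-1)^j (1-p^n)/(1-p^(n-j)) p^(j(j-3)/2) [n-j, j]_p], whose term [j = 0] is
    1 and whose term [j > 0] is [(1 - p^n) B_j].  Since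
    [1 - q^(2K) = -2(a-b)(1 - p^n)] modulo [Phi_n^2] and [A_j = - B_j] modulo
    [Phi_n], the two sides agree term by term.

    The evaluation of [vartheta_n] reduces to [F_(n+3) = - q^(n+1) F_n] for
    [F_n = sum_k (-1)^k q^(k(k-1)/2) [n-k, k]]. *)

(** * Gaussian binomials and the evaluation of [vartheta] *)

Section GaussianBinomials.

Variables (F : fieldType) (q : F).
Hypothesis q_not_root_of_1 : forall i : nat, (0 < i)%N -> q ^+ i != 1.

Lemma subr_exp_neq0 i : (0 < i)%N -> 1 - q ^+ i != 0.
Proof. by move=> i0; rewrite subr_eq0 eq_sym q_not_root_of_1. Qed.

Lemma qbinom_denom_neq0 m : \prod_(i < m) (1 - q ^+ i.+1) != 0.
Proof. by apply/prodf_neq0 => i _; apply: subr_exp_neq0. Qed.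

(* For [n < m] the factor [i = n] of the numerator is [1 - q ^+ 0]. *)
Lemma qbinomE n m :
  qbinom q n m =
    (\prod_(i < m) (1 - q ^+ (n - i))) / \prod_(i < m) (1 - q ^+ i.+1).
Proof.
rewrite /qbinom; case: leqP => // nm.
by rewrite (bigD1 (Ordinal nm)) //= subnn expr0 subrr !mul0r.
Qed.

Lemma qbinom_small n m : (n < m)%N -> qbinom q n m = 0.
Proof. by rewrite /qbinom ltnNge => /negbTE->. Qed.

Lemma qbinom0 n : qbinom q n 0 = 1.
Proof. by rewrite qbinomE !big_ord0 divr1. Qed.

Lemma qbinom_absorb n m :
  (1 - q ^+ m.+1) * qbinom q n.+1 m.+1 = (1 - q ^+ n.+1) * qbinom q n m.
Proof.
rewrite !qbinomE big_ord_recl subn0 [in X in _ * (_ / X)]big_ord_recr /=.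
have d0 := qbinom_denom_neq0 m; have e0 := subr_exp_neq0 m.+1 isT.
under eq_bigr => i _ do rewrite /bump /= add1n subSS.
by field; rewrite d0.
Qed.

Lemma qbinom_absorb_sub n m : (m <= n)%N ->
  (1 - q ^+ (n.+1 - m)) * qbinom q n.+1 m = (1 - q ^+ n.+1) * qbinom q n m.
Proof.
move=> mn; rewrite !qbinomE !mulrA; congr (_ / _).
have -> : (1 - q ^+ n.+1) * \prod_(i < m) (1 - q ^+ (n - i)) =
          \prod_(i < m.+1) (1 - q ^+ (n.+1 - i)).
  by rewrite big_ord_recl subn0; congr (_ * _).
by rewrite big_ord_recr /= mulrC.
Qed.

Lemma qbinom_pascal n m :
  qbinom q n.+1 m.+1 = q ^+ m.+1 * qbinom q n m.+1 + qbinom q n m.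
Proof.
have [nm|mn|->] := ltngtP n m; first by rewrite !qbinom_small ?(leqW nm) // mulr0 addr0.
(* After multiplication by [1 - q^(n+1)] everything is a multiple of [[n+1, m+1]], and what remains
   is [1 - q^(n+1) = q^(m+1) (1 - q^(n-m)) + (1 - q^(m+1))]. *)
- apply: (mulfI (subr_exp_neq0 n.+1 isT)).
  rewrite mulrDr mulrCA -(qbinom_absorb_sub _ _ mn) -qbinom_absorb.
  have -> : n.+1 = (m.+1 + (n.+1 - m.+1))%N by lia.
  by rewrite exprD addKn; ring.
- rewrite [in X in _ * X]qbinom_small // mulr0 add0r.
  apply: (mulfI (subr_exp_neq0 m.+1 isT)); exact: qbinom_absorb.
Qed.

Lemma qbinom_pascal_dual n m : (m <= n)%N ->
  qbinom q n.+1 m.+1 = qbinom q n m.+1 + q ^+ (n - m) * qbinom q n m.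
Proof.
rewrite leq_eqVlt => /predU1P[->|mn].
  by rewrite subnn mul1r qbinom_pascal (qbinom_small n n.+1) // mulr0.
apply: (mulfI (subr_exp_neq0 n.+1 isT)).
rewrite mulrDr [in RHS]mulrCA -(qbinom_absorb_sub _ _ mn) -qbinom_absorb.
have -> : n.+1 = (m.+1 + (n.+1 - m.+1))%N by lia.
by rewrite exprD addKn subSS; ring.
Qed.

Lemma qbinom_id n : qbinom q n n = 1.
Proof.
elim: n => [|n IH]; first exact: qbinom0.
apply: (mulfI (subr_exp_neq0 n.+1 isT)).
by rewrite qbinom_absorb IH.
Qed.

(** The reflection [m -> n - m] exchanges the two Pascal rules, so induction on [n] applies. *)
Lemma qbinom_sub n m : (m <= n)%N -> qbinom q n (n - m) = qbinom q n m.
Proof.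
elim: n m => [|n IH] [|m] //; rewrite ?subn0 ?qbinom0 ?qbinom_id // => mn.
rewrite subSS; case: (ltnP m n) => [lt_mn|le_nm]; last first.
  have -> : m = n by lia.
  by rewrite subnn qbinom0 qbinom_id.
have -> : (n - m = (n - m.+1).+1)%N by lia.
rewrite qbinom_pascal qbinom_pascal_dual ?(ltnW lt_mn) //.
have -> : (n - m.+1).+1 = (n - m)%N by lia.
by rewrite !IH ?(ltnW lt_mn) // addrC.
Qed.

Lemma qbinom_step N m :
  qbinom q N m.+1 * (1 - q ^+ m.+1) = qbinom q N m * (1 - q ^+ (N - m)).
Proof.
have d := qbinom_denom_neq0 m.
have e := subr_exp_neq0 m.+1 isT.
rewrite !qbinomE // !big_ord_recr /= invfM.
by rewrite mulrA mulfVK // mulrAC.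
Qed.

(** Iterates [qbinom_step] downwards from [K]. In base [q^2] it compares the outer binomial of the
    term [k = K - j] with that of the last term. *)
Lemma qbinom_descend N K j : (j <= K)%N -> (K <= N)%N ->
  qbinom q N (K - j) * \prod_(i < j) (1 - q ^+ (N - K + i.+1)) =
  qbinom q N K * \prod_(i < j) (1 - q ^+ (K - i)).
Proof.
move=> jK KN; elim: j jK => [|j IH] jK; first by rewrite !big_ord0 subn0.
rewrite !big_ord_recr /= [RHS]mulrA -IH ?(ltnW jK) // mulrCA [RHS]mulrAC mulrC.
congr (_ * _); have -> : (K - j = (K - j.+1).+1)%N by lia.
rewrite qbinom_step; congr (_ * (1 - q ^+ _)); lia.
Qed.

(** * The sums [F_n] and their three-step recurrence *)

Definition pent_sum n : F :=
  \sum_(k < n.+1) (-1) ^+ k * q ^+ 'C(k, 2) * qbinom q (n - k) k.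

(** The companion of [F_n] with an extra [q^k] in each term; Pascal's rules relate the two families,
    and it is then eliminated. *)
Definition pent_sum_shift n : F :=
  \sum_(k < n.+1) (-1) ^+ k * q ^+ 'C(k.+1, 2) * qbinom q (n - k) k.

(** Pascal's rule on [[n-k+1, k+1]]: the factor [q^(k+1)] raises [C(k+1, 2)] to [C(k+2, 2)], which
    gives one shifted sum; the other summand gives the second, with opposite sign. *)
Lemma pent_sum_rec n : pent_sum n.+2 = pent_sum_shift n.+1 - pent_sum_shift n.
Proof.
rewrite /pent_sum big_ord_recr /= subnn qbinom_small // mulr0 addr0.
rewrite /pent_sum_shift big_ord_recl [in RHS]big_ord_recl /= !subn0 !qbinom0.
rewrite -[RHS]addrA -sumrB; congr (_ + _); apply: eq_bigr => k _.
rewrite /bump /= add1n !subSS.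
have -> : (n.+1 - k = (n - k).+1)%N by have := ltn_ord k; lia.
rewrite qbinom_pascal [in 'C(k.+2, 2)]binS bin1 exprD exprS; ring.
Qed.

(** The dual Pascal rule contributes [q^(n-2k)], and [C(k+2, 2) + n - 2k = C(k, 2) + n + 1], so
    [q^(n+1)] comes out of the sum. *)
Lemma pent_sum_shift_rec n :
  pent_sum_shift n.+2 = pent_sum_shift n.+1 - q ^+ n.+1 * pent_sum n.
Proof.
rewrite /pent_sum_shift big_ord_recr /= subnn qbinom_small // mulr0 addr0.
rewrite big_ord_recl [in RHS]big_ord_recl /= !subn0 !qbinom0.
rewrite /pent_sum mulr_sumr -[RHS]addrA -sumrB; congr (_ + _).
apply: eq_bigr => k _; rewrite /bump /= add1n !subSS.
have kn := ltn_ord k; have -> : (n.+1 - k = (n - k).+1)%N by lia.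
have [le_k|lt_k] := leqP k (n - k); last first.
  by rewrite !qbinom_small ?(leq_trans lt_k) //; ring.
rewrite qbinom_pascal_dual // mulrDr exprS; congr (_ + _).
rewrite !mulN1r !mulNr; congr (- _).
rewrite -!mulrA [RHS]mulrCA; congr (_ * _); rewrite !mulrA -!exprD.
congr (q ^+ _ * _); rewrite !binS bin1 bin0; lia.
Qed.

Lemma pent_sum_step n : pent_sum n.+3 = - q ^+ n.+1 * pent_sum n.
Proof. by rewrite pent_sum_rec pent_sum_shift_rec; ring. Qed.

(** From the values 1, 1, 0 at [n = 0, 1, 2] in steps of three. The exponents are the pentagonal
    numbers [m(3m-1)/2] and [m(3m+1)/2]. *)
Lemma pent_sum_closed m :
  [/\ pent_sum (3 * m) = (-1) ^+ m * q ^+ (3 * 'C(m, 2) + m),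
      pent_sum (3 * m + 1) = (-1) ^+ m * q ^+ (3 * 'C(m, 2) + 2 * m)
    & pent_sum (3 * m + 2) = 0].
Proof.
elim: m => [|m [IH0 IH1 IH2]]; rewrite ?muln0.
  rewrite /pent_sum !big_ord_recr !big_ord0 /= !qbinom0.
  rewrite !(@qbinom_small 0) ?(@qbinom_small 0) //.
  rewrite qbinom_id.
  by split; rewrite ?muln0 ?(@bin_small 0 2) ?(@bin_small 1 2) ?mulr0 /=; try ring.
have e r : (3 * m.+1 + r = (3 * m + r).+3)%N by lia.
rewrite -{1}[(3 * m.+1)%N]addn0 !e !pent_sum_step addn0 IH0 IH1 IH2.
rewrite mulr0 binS bin1 ?addn0; split=> //; rewrite [(-1) ^+ m.+1]exprS.
  have -> : (3 * ('C(m, 2) + m) + m.+1 = (3 * m).+1 + (3 * 'C(m, 2) + m))%N by lia.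
  by rewrite [in RHS]exprD; ring.
have -> : (3 * ('C(m, 2) + m) + 2 * m.+1 = (3 * m + 1).+1 + (3 * 'C(m, 2) + 2 * m))%N by lia.
by rewrite [in RHS]exprD; ring.
Qed.

(* ['C(j, 2) - j = j(j-3)/2], which is negative for [j = 1, 2]. *)
Definition theta_term n j : F :=
  (-1) ^+ j * (q ^+ 'C(j, 2) / q ^+ j) * ((1 - q ^+ n) / (1 - q ^+ (n - j)))
    * qbinom q (n - j) j.

Hypothesis q_neq0 : q != 0.

Lemma theta_term0 n : (0 < n)%N -> theta_term n 0 = 1.
Proof.
move=> n0; rewrite /theta_term subn0 qbinom0 !expr0 divr1.
by rewrite divff ?subr_exp_neq0 // !mulr1.
Qed.

Lemma theta_termS n j : (j <= n)%N ->
  theta_term n.+2 j.+1 =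
    (-1) ^+ j.+1 * q ^+ 'C(j.+1, 2) * qbinom q (n.+2 - j.+1) j.+1
    - q^-1 * ((-1) ^+ j * q ^+ 'C(j, 2) * qbinom q (n - j) j).
Proof.
move=> jn; rewrite /theta_term.
have -> : (n.+2 - j.+1 = (n - j).+1)%N by lia.
have d := subr_exp_neq0 (n - j).+1 isT.
(* The first summand cancels the denominator and leaves a term of [F_(n+2)]; the second is absorbed
   into the binomial and leaves a term of [F_n]. *)
have -> : 1 - q ^+ n.+2 =
    q ^+ j.+1 * (1 - q ^+ (n - j).+1) + (1 - q ^+ j.+1).
  have -> : n.+2 = (j.+1 + (n - j).+1)%N by lia.
  by rewrite exprD; ring.
have -> : q ^+ 'C(j.+1, 2) = q ^+ 'C(j, 2) * q ^+ j by rewrite binS bin1 exprD.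
rewrite [_ * qbinom _ _ _ in LHS](_ : _ =
    (-1) ^+ j.+1 * (q ^+ 'C(j, 2) * q ^+ j / q ^+ j.+1)
      * (q ^+ j.+1 * qbinom q (n - j).+1 j.+1 + qbinom q (n - j) j)).
  by rewrite !exprS; field; rewrite q_neq0 expf_neq0.
rewrite -[LHS]mulrA; congr (_ * _).
rewrite mulrAC mulrDl -mulrA [(1 - q ^+ j.+1) * _]qbinom_absorb.
by field.
Qed.

Lemma sum_theta_term n :
  \sum_(j < n./2.+2) theta_term n.+2 j = pent_sum n.+2 - q^-1 * pent_sum n.
Proof.
(* For [2j > n + 2] the binomial [[n+2-j, j]] vanishes, so the range can be extended to match
   [pent_sum]. *)
transitivity (\sum_(j < n.+2) theta_term n.+2 j).
  rewrite -!(big_mkord xpredT (theta_term n.+2)).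
  rewrite [RHS](@big_cat_nat _ _ _ n./2.+2) //=; last by lia.
  rewrite [X in _ + X]big_nat_cond [X in _ + X]big1 ?addr0 // => j jP.
  by rewrite /theta_term qbinom_small ?mulr0 //; lia.
rewrite big_ord_recl theta_term0 // /pent_sum [in RHS]big_ord_recr /=.
rewrite subnn [qbinom q 0 _]qbinom_small // mulr0 addr0.
rewrite [in RHS]big_ord_recl /= subn0 qbinom0 mulr_sumr -[RHS]addrA -sumrB.
rewrite expr0 !mul1r; congr (_ + _); apply: eq_bigr => j _.
by rewrite /bump /= add1n theta_termS // -ltnS.
Qed.

Lemma vartheta_sum n : (0 < n)%N ->
  vartheta n q = \sum_(j < n./2.+1) theta_term n j.
Proof.
have zC m : (m%:Z * m%:Z = 2 * 'C(m, 2)%:Z + m%:Z)%R.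
  by have := bin2_sum m; rewrite bin2; have := mul_bin_diag m 1; rewrite bin1; nia.
case: n => [//|[_|n _]].
  by rewrite /vartheta /= big_ord_recl big_ord0 theta_term0 //= addr0; ring.
rewrite /= sum_theta_term.
rewrite /vartheta; set m := (n.+2 %/ 3)%N.
have := divn_eq n.+2 3; rewrite -/m; have := ltn_pmod n.+2 (isT : 0 < 3)%N.
(* For residue 0 both sums survive and produce the factor [1 + q^(2m)]; for residue 1 the subtracted
   sum vanishes, for residue 2 the leading one does. In each case the numerator of the exponent is
   first written as a multiple of 2, via [zC]. *)
case: (n.+2 %% 3)%N => [|[|[|//]]] _ nE.
- case: m nE => [|m] nE; first by lia.
  have [P0 _ _] := pent_sum_closed m.+1; have [_ P1 _] := pent_sum_closed m.
  have -> : (n.+2 = 3 * m.+1)%N by lia.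
  have -> : (n = 3 * m + 1)%N by lia.
  rewrite P0 P1.
  have -> : (m.+1%:Z * (3 * m.+1%:Z - 5))%R = ((3 * 'C(m, 2) + 2 * m)%:Z - 1) * 2.
    by have := zC m; lia.
  rewrite mulzK // expfzDr // exprN1.
  rewrite binS bin1.
  have -> : (3 * ('C(m, 2) + m) + m.+1 = (3 * 'C(m, 2) + 2 * m) + 2 * m + 1)%N by lia.
  have -> : (2 * m.+1 = 2 * m + 2)%N by lia.
  rewrite -exprnP !exprD [(-1) ^+ m.+1]exprS.
  by field; rewrite q_neq0.
- have [_ P1 _] := pent_sum_closed m.
  have -> : (n.+2 = 3 * m + 1)%N by lia.
  case: m nE P1 => [|m] nE P1; first by lia.
  have [_ _ P2] := pent_sum_closed m.
  have -> : (n = 3 * m + 2)%N by lia.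
  rewrite P1 P2 mulr0 subr0.
  have -> : (m.+1%:Z * (3 * m.+1%:Z + 1))%R = (3 * 'C(m.+1, 2) + 2 * m.+1)%:Z * 2.
    by have := zC m.+1; lia.
  by rewrite mulzK.
- have [P0 _ P2] := pent_sum_closed m.
  have -> : (n.+2 = 3 * m + 2)%N by lia.
  have -> : (n = 3 * m)%N by lia.
  rewrite P0 P2.
  have -> : ((m%:Z - 1) * (3 * m%:Z + 2))%R = ((3 * 'C(m, 2) + m)%:Z - 1) * 2.
    by have := zC m; lia.
  rewrite mulzK // expfzDr // exprN1 -exprnP exprS.
  by field.
Qed.

End GaussianBinomials.

(** * The terms of [t1'] relative to the last one *)

Lemma sum_nat_upper_segment (V : nmodType) K h (f : nat -> V) : (h <= K)%N ->
  \sum_(K - h <= k < K.+1) f k = \sum_(j < h.+1) f (K - j)%N.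
Proof.
move=> hK; rewrite big_nat_rev -{1}[(K - h)%N]add0n big_addn.
have -> : (K.+1 - (K - h) = h.+1)%N by lia.
rewrite big_mkord; apply: eq_bigr => j _; congr f; have := ltn_ord j; lia.
Qed.

Section TermRatio.

Variables (F : fieldType) (q : F).
Hypothesis q_not_root_of_1 : forall i : nat, (0 < i)%N -> q ^+ i != 1.

Lemma sqr_not_root_of_1 i : (0 < i)%N -> (q ^+ 2) ^+ i != 1.
Proof. by move=> i0; rewrite -exprM q_not_root_of_1 // muln_gt0. Qed.

Hypothesis q_neq0 : q != 0.

(* [A_(j+1)] in the notation of the introduction, for [L = b n]. *)
Definition t1_factor K L j : F :=
  (-1) ^+ j.+1 * (q ^+ (j.+1 * j.+2) * q^-1 ^+ (2 * j.+1 * K))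
    * (\prod_(i < j) ((1 - q ^+ (2 * (K - i.+1))) / (1 - q ^+ (2 * (L + i.+1)))))
    * (\prod_(i < j) (1 - q ^+ (2 * (L + j.+1) - i.+1)))
    / \prod_(i < j.+1) (1 - q ^+ i.+1).

(** With [J = j + 1] this is [(K-J)(K-J-1) = K(K-1) + J(J+1) - 2JK]; [q^-1] carries the negative
    part. *)
Lemma t1_weight K j : (j < K)%N ->
  (-1) ^+ (K - j.+1) * q ^+ ((K - j.+1) * (K - j.+1).-1) =
  (-1) ^+ K * q ^+ (K * K.-1)
    * ((-1) ^+ j.+1 * (q ^+ (j.+1 * j.+2) * q^-1 ^+ (2 * j.+1 * K))).
Proof.
move=> jK; rewrite mulrACA; congr (_ * _).
  by rewrite -[K in RHS](subnK jK) exprD -mulrA -expr2 sqrr_sign mulr1.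
rewrite exprVn mulrA; apply: (canRL (mulfK _)); first by rewrite expf_neq0.
rewrite -[RHS]exprD -[LHS]exprD; congr (q ^+ _).
have -> : K = ((K - j.+1) + j.+1)%N by lia.
move: (K - j.+1)%N => k; rewrite addnK; case: k => [|k]; rewrite ?add0n ?addSn /=; ring.
Qed.

(** In the ratio of the outer binomials the numerator starts with [1 - q^(2K)], which is kept apart,
    and the denominator ends with [1 - q^(2(L+j+1))], which cancels the first numerator factor of
    the inner binomial. *)
Lemma t1_term K L j : (j < K)%N ->
  (-1) ^+ (K - j.+1) * q ^+ ((K - j.+1) * (K - j.+1).-1)
    * qbinom (q ^+ 2) (K + L) (K - j.+1) * qbinom q (2 * (L + j.+1)) j.+1 =
  (-1) ^+ K * q ^+ (K * K.-1) * qbinom (q ^+ 2) (K + L) L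
    * ((1 - q ^+ (2 * K)) * t1_factor K L j).
Proof.
move=> jK.
have q2 := sqr_not_root_of_1.
have -> : qbinom (q ^+ 2) (K + L) L = qbinom (q ^+ 2) (K + L) K.
  by rewrite -(qbinom_sub _ _ q2) ?leq_addl // addnK.
rewrite t1_weight // /t1_factor prodf_div.
have := @qbinom_descend _ _ q2 (K + L) K j.+1 jK (leq_addr L K).
have ex i : (q ^+ 2) ^+ i = q ^+ (2 * i) by rewrite exprM.
set W := (-1) ^+ j.+1 * _.
rewrite [\prod_(i < j.+1) (1 - (q ^+ 2) ^+ (_ + _))]big_ord_recr.
rewrite [\prod_(i < j.+1) (1 - (q ^+ 2) ^+ (K - i))]big_ord_recl.
rewrite [qbinom q _ _]qbinomE // big_ord_recl /= !subn0 addKn !ex.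
under eq_bigr => i _ do rewrite ex.
under [X in _ = _ * (_ * X)]eq_bigr => i _ do rewrite ex /bump /= add1n.
under [X in _ * ((_ * X) / _)]eq_bigr => i _ do rewrite /bump /= add1n.
set Q := \prod_(i < j) (1 - q ^+ (2 * (L + i.+1))).
set A := \prod_(i < j) (1 - q ^+ (2 * (K - i.+1))).
set S := \prod_(i < j) _; set D := \prod_(i < j.+1) _ => desc.
have Q0 : Q != 0 by apply/prodf_neq0 => i _; apply: subr_exp_neq0 => //; lia.
move: desc; set X := qbinom _ _ (K - j.+1); set Y := qbinom _ _ K => desc.
have {}desc : Y * ((1 - q ^+ (2 * K)) * (A / Q)) = X * (1 - q ^+ (2 * (L + j.+1))).
  apply: (mulIf Q0); rewrite mulrA mulrA divfK // -[X * _ * Q]mulrA [_ * Q]mulrC.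
  by rewrite desc mulrA.
have -> : (-1) ^+ K * q ^+ (K * K.-1) * Y * ((1 - q ^+ (2 * K)) * (W * (A / Q) * S / D)) =
  (-1) ^+ K * q ^+ (K * K.-1) * W * S / D * (Y * ((1 - q ^+ (2 * K)) * (A / Q))).
  by move: (A / Q) D^-1 => x y; ring.
by rewrite desc; move: D^-1 => y; ring.
Qed.

Lemma prod_subr_exprV m :
  \prod_(i < m) (1 - q^-1 ^+ i.+1) =
  (-1) ^+ m * q^-1 ^+ 'C(m.+1, 2) * \prod_(i < m) (1 - q ^+ i.+1).
Proof.
elim: m => [|m IH]; first by rewrite !big_ord0 !expr0 !mulr1.
rewrite !big_ord_recr /= IH ['C(m.+2, 2)]binS bin1 [in RHS]exprD.
have -> : 1 - q^-1 ^+ m.+1 = - q^-1 ^+ m.+1 * (1 - q ^+ m.+1).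
  by rewrite mulNr mulrBr mulr1 -exprMn mulVf // expr1n opprB.
by rewrite [(-1) ^+ m.+1]exprS; ring.
Qed.

(** The cofactor of [1 - p^n] is [B_(j+1)]. The first numerator factor of the binomial cancels
    [1 - p^(n-j-1)]; passing to denominators in [q] removes the sign and leaves [q^(2(j+1))]. *)
Lemma theta_term_factor n j : (j.+1 < n)%N ->
  theta_term F q^-1 n j.+1 =
  (1 - q^-1 ^+ n) * (q ^+ (2 * j.+1)
    * (\prod_(i < j) (1 - q^-1 ^+ (n - j.+1 - i.+1)))
    / \prod_(i < j.+1) (1 - q ^+ i.+1)).
Proof.
move=> jn; have p1 i : (0 < i)%N -> q^-1 ^+ i != 1.
  by move=> i0; rewrite exprVn invr_eq1 q_not_root_of_1.
rewrite /theta_term qbinomE // big_ord_recl subn0.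
under eq_bigr => i _ do rewrite lift0.
have d : 1 - q^-1 ^+ (n - j.+1) != 0 by apply: subr_exp_neq0 => //; lia.
have D0 := qbinom_denom_neq0 _ _ q_not_root_of_1 j.+1.
rewrite prod_subr_exprV.
set A := \prod_(i < j) _; set D := \prod_(i < j.+1) _ in D0 *.
have -> : 'C(j.+2, 2) = ('C(j.+1, 2) + j.+1)%N by rewrite binS bin1.
rewrite exprD mul2n -addnn exprD.
have s0 : (-1) ^+ j.+1 != 0 :> F by rewrite signr_eq0.
have c0 : q^-1 ^+ 'C(j.+1, 2) != 0 by rewrite expf_neq0 ?invr_eq0.
have -> : q^-1 ^+ j.+1 = (q ^+ j.+1)^-1 by rewrite exprVn.
have u0 : q ^+ j.+1 != 0 by rewrite expf_neq0.
move: (1 - q^-1 ^+ n) (1 - q^-1 ^+ (n - j.+1)) d ((-1) ^+ j.+1 : F) s0 => N d d0 s s0.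
move: (q^-1 ^+ 'C(j.+1, 2)) c0 (q ^+ j.+1) u0 A D D0 => c c0 u u0 A D D0.
by field; rewrite D0 u0 c0 s0 d0 oner_neq0.
Qed.
End TermRatio.

(** * Congruences modulo powers of ['Phi_n] *)

(** A nontrivial common divisor would have a root in [algC]; as a root of ['Phi_n] it is a primitive
    [n]-th root of 1, where [Q] does not vanish. *)
Lemma coprimep_Cyclotomic n (Q : {poly int}) : (0 < n)%N ->
  (forall z : algC, n.-primitive_root z -> ~~ root (map_poly intr Q) z) ->
  coprimep Q 'Phi_n.
Proof.
move=> n0 Qz; have [w w_prim] := C_prim_root_exists n0.
rewrite /coprimep; apply/negPn/negP => size_gcd.
have inj : injective (intr : int -> algC) by apply: intr_inj.
have size_map (p : {poly int}) : size (map_poly (intr : int -> algC) p) = size p.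
  by apply: size_map_inj_poly.
set g := gcdp Q 'Phi_n in size_gcd.
have /closed_rootP[z gz] : size (map_poly (intr : int -> algC) g) != 1%N.
  by rewrite size_map.
(* Over [int], divisibility holds only up to a nonzero scalar [c], which is harmless for roots. *)
have root_of p : g %| p -> root (map_poly intr p) z.
  case/Pdiv.Idomain.dvdpP => -[c r] /= c0 /(congr1 (map_poly (intr : int -> algC))).
  rewrite map_polyZ rmorphM /= => /(congr1 (horner^~ z)) /eqP.
  rewrite hornerZ hornerM (rootP gz) mulr0 mulf_eq0 intr_eq0 (negPf c0) /=.
  by rewrite rootE.
have := root_of _ (dvdp_gcdr Q 'Phi_n).
rewrite (Cintr_Cyclotomic w_prim) (root_cyclotomic w_prim) => /Qz /negP; apply.
exact: root_of (dvdp_gcdl Q 'Phi_n).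
Qed.

Lemma subr_inv (F : fieldType) (x y : F) : x != 0 -> y != 0 ->
  x^-1 - y^-1 = - (x^-1 * y^-1 * (x - y)).
Proof. by move=> x0 y0; field; apply/andP. Qed.

(** * The local ring at ['Phi_n] and its congruences *)

Section Localization.

Variables (F : fieldType) (iota : {rmorphism {poly int} -> F}).
Hypothesis iota_inj : injective iota.
Variable n : nat.
Hypothesis n_gt0 : (0 < n)%N.

Local Notation q := (iota 'X).

Lemma iota_eq0 P : (iota P == 0) = (P == 0).
Proof. by rewrite -[0 in LHS](rmorph0 iota) (inj_eq iota_inj). Qed.

Lemma iotaX_neq0 : q != 0.
Proof. by rewrite iota_eq0 polyX_eq0. Qed.

Lemma iotaX_not_root_of_1 i : (0 < i)%N -> q ^+ i != 1.
Proof.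
move=> i0; rewrite -rmorphXn -[1](rmorph1 iota) -subr_eq0 -rmorphB iota_eq0.
by rewrite -size_poly_eq0 size_XnsubC.
Qed.

(** The image in [F] of the localization of [Z[X]] at the prime ['Phi_n]. *)
Definition regular (x : F) : Prop :=
  exists P Q : {poly int}, coprimep Q 'Phi_n /\ x = iota P / iota Q.

(** Only the difference has to lie in the local ring, hence the regularity conditions in the rules
    for products. *)
Definition eqmod e (x y : F) : Prop :=
  exists2 r, regular r & x - y = iota 'Phi_n ^+ e * r.

Lemma coprimep_Phi_neq0 (Q : {poly int}) : coprimep Q 'Phi_n -> Q != 0.
Proof.
apply: contraTneq => ->.
rewrite coprimep_sym coprimep0 -size_poly_eq1 size_Cyclotomic eqSS.
by rewrite -lt0n totient_gt0.
Qed.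

Lemma regular_iota P : regular (iota P).
Proof. by exists P, 1; rewrite coprime1p (rmorph1 iota) divr1. Qed.

Lemma regularD x y : regular x -> regular y -> regular (x + y).
Proof.
move=> [P [Q [cQ ->]]] [R [S [cS ->]]].
exists (P * S + R * Q), (Q * S); split; first by rewrite coprimepMl cQ.
rewrite rmorphD !rmorphM addf_div //; rewrite iota_eq0; exact: coprimep_Phi_neq0.
Qed.

Lemma regularM x y : regular x -> regular y -> regular (x * y).
Proof.
move=> [P [Q [cQ ->]]] [R [S [cS ->]]].
exists (P * R), (Q * S); split; first by rewrite coprimepMl cQ.
by rewrite !rmorphM mulf_div.
Qed.

Lemma regularN x : regular x -> regular (- x).
Proof.
rewrite -mulN1r -(rmorph1 iota) -rmorphN; apply: regularM; exact: regular_iota.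
Qed.

Lemma regularB x y : regular x -> regular y -> regular (x - y).
Proof. by move=> rx ry; apply/regularD/regularN. Qed.

Lemma regular0 : regular 0. Proof. rewrite -(rmorph0 iota); exact: regular_iota. Qed.
Lemma regular1 : regular 1. Proof. rewrite -(rmorph1 iota); exact: regular_iota. Qed.

Lemma regularX x i : regular x -> regular (x ^+ i).
Proof.
by move=> rx; elim: i => [|i IH]; rewrite ?exprS; [apply: regular1 | apply: regularM].
Qed.

Lemma regular_iotaX i : regular (q ^+ i).
Proof. by apply: regularX; apply: regular_iota. Qed.

Lemma regular_prod (I : Type) (r : seq I) (P : pred I) f :
  (forall i, P i -> regular (f i)) -> regular (\prod_(i <- r | P i) f i).
Proof. by move=> rf; apply: big_ind; [apply: regular1 | apply: regularM |]. Qed.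

(** Pascal's rule avoids the denominators, which may be divisible by ['Phi_n]. *)
Lemma regular_qbinom q m k : (forall i, (0 < i)%N -> q ^+ i != 1) ->
  regular q -> regular (qbinom q m k).
Proof.
move=> q1 rq; elim: m k => [|m IH] [|k].
- by rewrite qbinom0; apply: regular1.
- by rewrite qbinom_small //; apply: regular0.
- by rewrite qbinom0; apply: regular1.
- rewrite qbinom_pascal //; apply/regularD/IH/regularM/IH; exact: regularX.
Qed.

Lemma eqmod_refl e x : eqmod e x x.
Proof. by exists 0; [apply: regular0 | rewrite mulr0 subrr]. Qed.

Lemma eqmod_sym e x y : eqmod e x y -> eqmod e y x.
Proof. by case=> r rr xy; exists (- r); [apply: regularN | rewrite mulrN -xy opprB]. Qed.

Lemma eqmod_trans e x y z : eqmod e x y -> eqmod e y z -> eqmod e x z.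
Proof.
move=> [r rr xy] [s rs yz]; exists (r + s); first exact: regularD.
by rewrite mulrDr -xy -yz; ring.
Qed.

Lemma eqmodD e x y z t : eqmod e x y -> eqmod e z t -> eqmod e (x + z) (y + t).
Proof.
move=> [r rr xy] [s rs zt]; exists (r + s); first exact: regularD.
by rewrite mulrDr -xy -zt; ring.
Qed.

Lemma eqmodN e x y : eqmod e x y -> eqmod e (- x) (- y).
Proof.
by move=> [r rr xy]; exists (- r); [apply: regularN | rewrite mulrN -xy; ring].
Qed.

Lemma eqmodB e x y z t : eqmod e x y -> eqmod e z t -> eqmod e (x - z) (y - t).
Proof. by move=> xy zt; apply/eqmodD/eqmodN. Qed.

Lemma eqmodMl e x y z : regular z -> eqmod e x y -> eqmod e (z * x) (z * y).
Proof.
by move=> rz [r rr xy]; exists (z * r); [apply: regularM | rewrite mulrCA -xy; ring].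
Qed.

Lemma eqmodM e x y z t : regular x -> regular t ->
  eqmod e x y -> eqmod e z t -> eqmod e (x * z) (y * t).
Proof.
move=> rx rt xy zt; apply: (eqmod_trans _ _ (x * t)); first exact: eqmodMl.
by rewrite ![_ * t]mulrC; apply: eqmodMl.
Qed.

Lemma eqmod_sum e (I : Type) (r : seq I) (P : pred I) f g :
  (forall i, P i -> eqmod e (f i) (g i)) ->
  eqmod e (\sum_(i <- r | P i) f i) (\sum_(i <- r | P i) g i).
Proof.
by move=> fg; apply: big_ind2 => //; [apply: eqmod_refl | move=> *; apply: eqmodD].
Qed.

Lemma eqmod_prod e (I : Type) (r : seq I) (P : pred I) f g :
  (forall i, P i -> regular (f i)) -> (forall i, P i -> regular (g i)) ->
  (forall i, P i -> eqmod e (f i) (g i)) ->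
  eqmod e (\prod_(i <- r | P i) f i) (\prod_(i <- r | P i) g i).
Proof.
move=> rf rg fg; elim: r => [|i r IH]; first by rewrite !big_nil; apply: eqmod_refl.
rewrite !big_cons; case: ifP => // Pi.
by apply: eqmodM => //; [apply: rf | apply: regular_prod | apply: fg].
Qed.

Lemma eqmodV e x y : x != 0 -> y != 0 -> regular x^-1 -> regular y^-1 ->
  eqmod e x y -> eqmod e x^-1 y^-1.
Proof.
move=> x0 y0 rx ry [r rr xy]; exists (- (x^-1 * y^-1 * r)).
  by apply/regularN/regularM => //; apply: regularM.
rewrite subr_inv // xy mulrN; congr (- _); exact: mulrCA.
Qed.

(** * Powers of [q] at the primitive [n]-th roots of 1 *)

Lemma regular_subr_exp_inv i : ~~ (n %| i)%N -> regular (1 - q ^+ i)^-1.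
Proof.
move=> ni; exists 1, (1 - 'X^i); split; last first.
  by rewrite rmorphB (rmorph1 iota) rmorphXn div1r.
apply: coprimep_Cyclotomic => // z z_prim.
rewrite rmorphB rmorph1 /= map_polyXn rootE hornerD hornerN hornerXn hornerC.
by rewrite subr_eq0 eq_sym -(prim_order_dvd z_prim).
Qed.

Lemma regular_iotaXV i : regular ((q^-1) ^+ i).
Proof.
apply: regularX; exists 1, 'X; split; last by rewrite (rmorph1 iota) div1r.
apply: coprimep_Cyclotomic => // z z_prim.
rewrite map_polyX rootE hornerX; apply/eqP => z0; move: (prim_expr_order z_prim).
by rewrite z0 expr0n gtn_eqF // => /eqP; rewrite eq_sym oner_eq0.
Qed.

Lemma eqmod_iotaX_n : eqmod 1 (q ^+ n) 1.
Proof.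
rewrite -rmorphXn -(rmorph1 iota) /eqmod -rmorphB -(prod_Cyclotomic n_gt0).
rewrite (bigD1_seq n) ?divisors_uniq -?dvdn_divisors //= rmorphM.
exists (iota (\prod_(d <- divisors n | d != n) 'Phi_d)) => //.
exact: regular_iota.
Qed.

Lemma eqmod1X x i : regular x -> eqmod 1 x 1 -> eqmod 1 (x ^+ i) 1.
Proof.
move=> rx x1; elim: i => [|i IH]; first exact: eqmod_refl.
by rewrite exprS -[1]mulr1; apply: eqmodM => //; apply: regular1.
Qed.

Lemma eqmod_iotaX_mul i : eqmod 1 (q ^+ (n * i)) 1.
Proof. by rewrite exprM; apply: eqmod1X eqmod_iotaX_n; apply: regular_iotaX. Qed.

Lemma eqmod_iotaXV_n : eqmod 1 ((q^-1) ^+ n) 1.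
Proof.
rewrite exprVn -[1]invr1; apply: eqmodV; rewrite ?expf_neq0 ?iotaX_neq0 ?oner_eq0 //.
- by rewrite -exprVn; apply: regular_iotaXV.
- by rewrite invr1; apply: regular1.
- exact: eqmod_iotaX_n.
Qed.

Lemma regular_subr_iotaXV i : regular (1 - q^-1 ^+ i).
Proof. by apply: regularB; [apply: regular1 | apply: regular_iotaXV]. Qed.

Lemma regular_subr_iotaX i : regular (1 - q ^+ i).
Proof. by apply: regularB; [apply: regular1 | apply: regular_iotaX]. Qed.

Lemma eqmod_subr1 x y : eqmod 1 x y -> eqmod 1 (1 - x) (1 - y).
Proof. by move=> xy; apply: eqmodB xy; apply: eqmod_refl. Qed.

(** The source of the second power of ['Phi_n]: beside a factor that vanishes modulo ['Phi_n], the
    cofactor matters only modulo ['Phi_n]. *)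
Lemma eqmodMzero e f x y z : eqmod e z 0 -> eqmod f x y ->
  eqmod (e + f) (z * x) (z * y).
Proof.
move=> [r rr]; rewrite subr0 => -> [s rs xy]; exists (r * s); first exact: regularM.
by rewrite -mulrBr xy exprD mulrACA.
Qed.

Lemma eqmod_iotaX_mulD i m : (n %| m)%N -> eqmod 1 (q ^+ (m + i)) (q ^+ i).
Proof.
move=> /dvdnP[k ->]; rewrite exprD -[X in eqmod _ _ X]mul1r mulnC.
by apply: eqmodM (eqmod_refl _ _); [apply: regular_iotaX.. | apply: eqmod_iotaX_mul].
Qed.

Lemma eqmod_iotaXV_mul i : eqmod 1 (q^-1 ^+ (n * i)) 1.
Proof.
rewrite exprM; apply: eqmod1X eqmod_iotaXV_n; exact: regular_iotaXV.
Qed.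

(* The value of [B_(j+1)] and of [- A_(j+1)] at [q^n = 1]. *)
Definition common_factor j : F :=
  q ^+ (2 * j.+1) * (\prod_(i < j) (1 - q ^+ (j.+1 + i.+1)))
    / \prod_(i < j.+1) (1 - q ^+ i.+1).

(** * Reduction of [A_j] and [B_j] modulo ['Phi_n] *)

Lemma regular_prod_subr_inv m : (m < n)%N ->
  regular (\prod_(i < m) (1 - q ^+ i.+1))^-1.
Proof.
move=> mn; rewrite -prodfV; apply: regular_prod => i _.
apply: regular_subr_exp_inv; rewrite gtnNdvd //; have := ltn_ord i; lia.
Qed.

Lemma eqmod_theta_factor j : (j < n./2)%N ->
  eqmod 1 (q ^+ (2 * j.+1) * (\prod_(i < j) (1 - q^-1 ^+ (n - j.+1 - i.+1)))
             / \prod_(i < j.+1) (1 - q ^+ i.+1)) (common_factor j).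
Proof.
move=> jn; rewrite /common_factor -!mulrA; apply: eqmodMl; first exact: regular_iotaX.
have rV := regular_prod_subr_inv j.+1; apply: eqmodM (eqmod_refl _ _) => //.
- by apply: regular_prod => i _; apply: regular_subr_iotaXV.
- by apply: rV; lia.
apply: eqmod_prod => i _; [exact: regular_subr_iotaXV|exact: regular_subr_iotaX|].
apply: eqmod_subr1; set k := (j.+1 + i.+1)%N.
have kn : (k <= n)%N by have := ltn_ord i; lia.
(* Isolates [p^n], which is 1 modulo ['Phi_n]. *)
have -> : q^-1 ^+ (n - j.+1 - i.+1) = q^-1 ^+ n * q ^+ k.
  have -> : (n - j.+1 - i.+1 = n - k)%N by lia.
  rewrite -[X in q^-1 ^+ X * _](subnK kn) exprD -mulrA -exprMn mulVf ?iotaX_neq0 //.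
  by rewrite expr1n mulr1.
rewrite -[X in eqmod _ _ X]mul1r; apply: eqmodM (eqmod_refl _ _).
- exact: regular_iotaXV.
- exact: regular_iotaX.
- exact: eqmod_iotaXV_n.
Qed.

(** Gives the common value the shape of [t1_factor], for a comparison factor by factor. The powers
    of [q] agree because [(j+1)(j+2) - j(j+1) = 2(j+1)]. *)
Lemma common_factorE j :
  - common_factor j =
  (-1) ^+ j.+1 * (q ^+ (j.+1 * j.+2) * 1) * (\prod_(i < j) - q^-1 ^+ (2 * i.+1))
    * (\prod_(i < j) (1 - q ^+ (j.+1 + i.+1))) / \prod_(i < j.+1) (1 - q ^+ i.+1).
Proof.
have -> : \prod_(i < j) - q^-1 ^+ (2 * i.+1) = (-1) ^+ j * q^-1 ^+ (j * j.+1).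
  elim: j => [|j IH]; first by rewrite big_ord0 !expr0 mulr1.
  rewrite big_ord_recr /= IH [(-1) ^+ j.+1]exprS.
  have -> : (j.+1 * j.+2 = j * j.+1 + 2 * j.+1)%N by lia.
  by rewrite exprD; ring.
have -> : (j.+1 * j.+2 = 2 * j.+1 + j * j.+1)%N by lia.
rewrite /common_factor exprD mulr1 exprVn; have := iotaX_neq0.
move=> /(expf_neq0 (j * j.+1)); move: (q ^+ (j * j.+1)) => u u0.
have sgn : (-1) ^+ j.+1 * (-1) ^+ j = -1 :> F.
  by rewrite exprS -mulrA -expr2 sqrr_sign mulr1.
rewrite [_ * ((-1) ^+ j / u)]mulrACA sgn mulfK // mulN1r !mulNr.
by [].
Qed.

(** Multiples of [n] drop out of the exponents, leaving [(1 - q^(-2i)) / (1 - q^(2i)) = - q^(-2i)];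
    the bounds [0 < 2i < n] keep the denominators invertible. *)
Lemma eqmod_t1_quotient L s i : (n %| L)%N -> (0 < i)%N -> (2 * i < n)%N -> (0 < s)%N ->
  regular ((1 - q ^+ (2 * (s * n - i))) / (1 - q ^+ (2 * (L + i)))) /\
  eqmod 1 ((1 - q ^+ (2 * (s * n - i))) / (1 - q ^+ (2 * (L + i))))
          (- q^-1 ^+ (2 * i)).
Proof.
move=> nL i0 i2 s0.
have n2L : (n %| 2 * L)%N by rewrite dvdn_mull.
have ndvd : ~~ (n %| 2 * (L + i))%N.
  by rewrite mulnDr dvdn_addr // gtnNdvd // muln_gt0.
have ndvd' : ~~ (n %| 2 * i)%N by rewrite gtnNdvd // muln_gt0.
have rV := regular_subr_exp_inv _ ndvd; have rV' := regular_subr_exp_inv _ ndvd'.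
have d0 : 1 - q ^+ (2 * i) != 0.
  by apply: subr_exp_neq0; [exact: iotaX_not_root_of_1 | rewrite muln_gt0].
split; first by apply: regularM => //; apply: regular_subr_iotaX.
have -> : - q^-1 ^+ (2 * i) = (1 - q^-1 ^+ (2 * i)) / (1 - q ^+ (2 * i)).
  apply: (canRL (mulfK d0)); rewrite mulNr mulrBr mulr1 -exprMn.
  by rewrite mulVf ?iotaX_neq0 // expr1n opprB.
apply: eqmodM => //; first exact: regular_subr_iotaX.
  apply: eqmod_subr1.
  have le_i : (2 * i <= 2 * (s * n))%N by nia.
  have -> : q ^+ (2 * (s * n - i)) = q ^+ (2 * (s * n)) * q^-1 ^+ (2 * i).
    have -> : (2 * (s * n - i) = 2 * (s * n) - 2 * i)%N by lia.
    rewrite -[X in _ = q ^+ X * _](subnK le_i) exprD -mulrA -exprMn.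
    by rewrite mulfV ?iotaX_neq0 // expr1n mulr1.
  rewrite -[X in eqmod _ _ X]mul1r; apply: eqmodM (eqmod_refl _ _).
  - exact: regular_iotaX.
  - exact: regular_iotaXV.
  - by rewrite mulnA mulnC; apply: eqmod_iotaX_mul.
apply: eqmodV => //.
  by apply: subr_exp_neq0; [exact: iotaX_not_root_of_1 | lia].
by apply: eqmod_subr1; rewrite mulnDr; apply: eqmod_iotaX_mulD.
Qed.

Lemma eqmod_t1_factor s b j : (j < n./2)%N -> (0 < s)%N ->
  eqmod 1 (t1_factor F q (s * n) (b * n) j) (- common_factor j).
Proof.
move=> jn s0; rewrite common_factorE /t1_factor.
have rV : regular (\prod_(i < j.+1) (1 - q ^+ i.+1))^-1.
  by apply: regular_prod_subr_inv; lia.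
have nL : (n %| b * n)%N by rewrite dvdn_mull.
have quo (i : 'I_j) hi := eqmod_t1_quotient (b * n) s i.+1 nL isT hi s0.
have i2 (i : 'I_j) : (2 * i.+1 < n)%N by have := ltn_ord i; lia.
have rW : regular ((-1) ^+ j.+1 * (q ^+ (j.+1 * j.+2) * q^-1 ^+ (2 * j.+1 * (s * n)))).
  apply: regularM; first by apply: regularX; apply: regularN; apply: regular1.
  by apply: regularM; [apply: regular_iotaX | apply: regular_iotaXV].
have rQ : regular (\prod_(i < j) ((1 - q ^+ (2 * (s * n - i.+1))) /
                                    (1 - q ^+ (2 * (b * n + i.+1))))).
  by apply: regular_prod => i _; have [] := quo i (i2 i).
have rS : regular (\prod_(i < j) (1 - q ^+ (2 * (b * n + j.+1) - i.+1))).
  by apply: regular_prod => i _; apply: regular_subr_iotaX.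
apply: eqmodM (eqmod_refl _ _) => //.
  by apply: regularM => //; apply: regularM.
apply: eqmodM.
- exact: regularM.
- by apply: regular_prod => i _; apply: regular_subr_iotaX.
- apply: eqmodM => //.
  + by apply: regular_prod => i _; apply: regularN; apply: regular_iotaXV.
  + apply: eqmodMl; first by apply: regularX; apply: regularN; apply: regular1.
    apply: eqmodMl; first exact: regular_iotaX.
    by rewrite mulnA mulnC; apply: eqmod_iotaXV_mul.
  + apply: eqmod_prod => i _.
    * by have [] := quo i (i2 i).
    * by apply: regularN; apply: regular_iotaXV.
    * by have [] := quo i (i2 i).
(* Modulo [n] the exponents on the left descend from [2j+1] to [j+2], while those of the common
   factor ascend over the same range. *)
- rewrite [X in eqmod _ _ X](reindex_inj rev_ord_inj).
  apply: eqmod_prod => i _; rewrite /=; [exact: regular_subr_iotaX..|].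
  apply: eqmod_subr1.
  have -> : (2 * (b * n + j.+1) - i.+1 = 2 * (b * n) + (j.+1 + (j - i.+1).+1))%N.
    by have := ltn_ord i; lia.
  by apply: eqmod_iotaX_mulD; rewrite dvdn_mull.
Qed.

(** * The congruence modulo the square of ['Phi_n] *)

Lemma eqmod_coefficient s :
  eqmod 2 (1 - q ^+ (2 * (s * n))) (- (2 * s%:R * (1 - q^-1 ^+ n))).
Proof.
set y := q ^+ n; have y0 : y != 0 by rewrite expf_neq0 ?iotaX_neq0.
have -> : q ^+ (2 * (s * n)) = y ^+ (2 * s) by rewrite -exprM mulnA mulnC.
have ry : eqmod 1 (1 - y) 0.
  rewrite -[0](subrr 1); apply: eqmod_subr1; exact: eqmod_iotaX_n.
(* Both sides become [1 - y] times a sum of [2s] terms, each congruent to 1 modulo ['Phi_n]. *)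
have -> : 1 - y ^+ (2 * s) = (1 - y) * \sum_(i < 2 * s) y ^+ i.
  by rewrite -[LHS]opprB subrX1 -mulNr opprB.
have -> : - (2 * s%:R * (1 - q^-1 ^+ n)) = (1 - y) * \sum_(i < 2 * s) y^-1.
  rewrite sumr_const card_ord -[y^-1 *+ _]mulr_natr natrM exprVn -/y.
  by field.
apply: (eqmodMzero 1 1) => //; apply: eqmod_sum => i _.
apply: (eqmod_trans _ _ 1).
  by apply: eqmod1X; [apply: regular_iotaX | apply: eqmod_iotaX_n].
by apply: eqmod_sym; rewrite -exprVn; apply: eqmod_iotaXV_n.
Qed.

Lemma eqmod_t1_theta_term s b j : (j < n./2)%N -> (0 < s)%N ->
  eqmod 2 ((1 - q ^+ (2 * (s * n))) * t1_factor F q (s * n) (b * n) j)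
          (2 * s%:R * theta_term F q^-1 n j.+1).
Proof.
move=> jn s0; have jn' : (j.+1 < n)%N by lia.
rewrite theta_term_factor //; [|exact: iotaX_not_root_of_1|exact: iotaX_neq0].
set B := _ / _.
have rB : regular B.
  apply: regularM; last exact: regular_prod_subr_inv.
  apply: regularM; first exact: regular_iotaX.
  by apply: regular_prod => i _; apply: regular_subr_iotaXV.
(* First [A] is replaced by [- B], needed only modulo ['Phi_n] next to [1 - q^(2K)]; then that
   coefficient is replaced modulo the square. *)
apply: (eqmod_trans _ _ ((1 - q ^+ (2 * (s * n))) * - B)).
  apply: (eqmodMzero 1 1).
    rewrite -[0](subrr 1); apply: eqmod_subr1.
    by rewrite mulnA mulnC; apply: eqmod_iotaX_mul.
  apply: eqmod_trans (eqmod_t1_factor _ _ _ jn s0) _.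
  by apply/eqmodN/eqmod_sym/eqmod_theta_factor.
have -> : (1 - q ^+ (2 * (s * n))) * - B = - B * (1 - q ^+ (2 * (s * n))).
  exact: mulrC.
have -> : 2 * s%:R * ((1 - q^-1 ^+ n) * B) = - B * - (2 * s%:R * (1 - q^-1 ^+ n)).
  by ring.
by apply: eqmodMl; [apply: regularN | apply: eqmod_coefficient].
Qed.

Lemma t1'_eqmod a b : (0 < b)%N -> (b < a)%N ->
  eqmod 2 (t1' q a b n)
    ((-1) ^+ (a * n - b * n) * q ^+ ((a * n - b * n) * (a * n - b * n).-1)
       * qbinom (q ^+ 2) (a * n) (b * n)
       * (1 - 2 * (a%:R - b%:R) * (1 - vartheta n q^-1))).
Proof.
move=> b0 ab; have q1 := iotaX_not_root_of_1.
have p1 i : (0 < i)%N -> q^-1 ^+ i != 1.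
  by move=> i0; rewrite exprVn invr_eq1 q1.
have q21 := sqr_not_root_of_1 _ _ q1.
rewrite -natrB ?(ltnW ab) // /t1' -mulnBl.
set s := (a - b)%N; have s0 : (0 < s)%N by rewrite subn_gt0.
have aE : (a * n = s * n + b * n)%N by rewrite -mulnDl subnK // ltnW.
(* Reindexing by [j = K - k] is possible since [n./2 <= s * n]; the index [j = 0] then yields the
   prefactor [M]. *)
rewrite sum_nat_upper_segment; last by nia.
rewrite aE big_ord_recl subn0.
have -> : qbinom q (2 * (s * n + b * n) - 2 * (s * n)) (s * n - s * n) = 1.
  by rewrite subnn qbinom0.
set M := _ * qbinom _ _ (b * n).
have -> : (-1) ^+ (s * n) * q ^+ (s * n * (s * n).-1)
            * qbinom (q ^+ 2) (s * n + b * n) (s * n) * 1 = M.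
  by rewrite mulr1 /M -(qbinom_sub _ _ q21 _ (b * n)) ?leq_addl // addnK.
have -> : \sum_(i < n./2) (-1) ^+ (s * n - lift ord0 i)
     * q ^+ ((s * n - lift ord0 i) * (s * n - lift ord0 i).-1)
     * qbinom (q ^+ 2) (s * n + b * n) (s * n - lift ord0 i)
     * qbinom q (2 * (s * n + b * n) - 2 * (s * n - lift ord0 i))
                (s * n - (s * n - lift ord0 i)) =
  \sum_(i < n./2) M * ((1 - q ^+ (2 * (s * n))) * t1_factor F q (s * n) (b * n) i).
  apply: eq_bigr => i _; rewrite lift0.
  have iK : (i < s * n)%N by have := ltn_ord i; nia.
  have -> : (2 * (s * n + b * n) - 2 * (s * n - i.+1) = 2 * (b * n + i.+1))%N.
    by lia.
  have -> : (s * n - (s * n - i.+1) = i.+1)%N by lia.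
  by rewrite t1_term //; apply: iotaX_neq0.
(* The term [j = 0] of [vartheta] cancels the 1 in [1 - vartheta], so both sides are [M] plus sums
   over [0 < j <= n./2]. *)
rewrite vartheta_sum ?invr_eq0 ?iotaX_neq0 // big_ord_recl theta_term0 //.
rewrite opprD addNKr mulrN opprK mulrDr mulr1 -mulr_sumr.
have rM : regular M.
  apply: regularM.
    by apply: regularM; [apply/regularX/regularN/regular1 | apply: regular_iotaX].
  by apply: regular_qbinom => //; apply: regular_iotaX.
apply: eqmodD; first exact: eqmod_refl.
apply: eqmodMl => //; rewrite mulr_sumr; apply: eqmod_sum => i _.
by rewrite lift0; apply: eqmod_t1_theta_term.
Qed.

End Localization.

Theorem theorem1p7 (a b n : nat) (ha : (0 < a)%N) (hb : (0 < b)%N)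
    (hn : (0 < n)%N) (hab : (b < a)%N) :
  eqmodPhi2 n
    (t1' ratX a b n)
    ((-1) ^+ (a * n - b * n) * ratX ^+ ((a * n - b * n) * (a * n - b * n).-1)
       * qbinom (ratX ^+ 2) (a * n) (b * n)
       * (1 - 2 * (a%:R - b%:R) * (1 - vartheta n ratX^-1))).
Proof.
have inj : injective (@tofrac {poly int}).
  by move=> x y /eqP; rewrite tofrac_eq => /eqP.
have [r [P [Q [cQ rE]]] xy] := t1'_eqmod _ (@tofrac {poly int}) inj n hn a b hb hab.
exists P, Q; split=> //.
apply: (etrans xy).
by rewrite rE tofracM tofracXn mulrA.
Qed.
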